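(* Let $(X,d)$ be a compact metric space containing at least two points and let $f:X\to X$ be a continuous map. If $f$ has asymptotic average shadowing, then $f$ has mean ergodic shadowing.
   Context: $\mathbb{N}$ denotes the set of non-negative integers. A set $E\subset\mathbb{N}$ has density zero if $\lim_{n\to\infty}\frac{1}{n}\#(E\cap\{0,1,\dots,n-1\})=0$. Asymptotic average shadowing: a sequence $\{x_i\}_{i\in\mathbb{N}}$ in $X$ is an asymptotic average pseudo orbit for $f$ if $\lim_{n\to\infty}\frac1n\sum_{i=0}^{n-1}d(f(x_i),x_{i+1})=0$; it is asymptotically shadowed in average by $x\in X$ if $\lim_{n\to\infty}\frac1n\sum_{i=0}^{n-1}d(f^i(x),x_i)=0$. The map $f$ has asymptotic average shadowing if every asymptotic average pseudo orbit is asymptotically shadowed in average by some point of $X$. Mean ergodic shadowing: a sequence $\{x_i\}_{i\in\mathbb{N}}$ in $X$ is a $\delta$-ergodic pseudo orbit for $f$ if the set $\{i\in\mathbb{N}: d(f(x_i),x_{i+1})\ge\delta\}$ has density zero. It is $\epsilon$-shadowed in average by $x\in X$ if $\limsup_{n\to\infty}\frac1n\sum_{i=0}^{n-1}d(f^i(x),x_i)<\epsilon$. The map $f$ has mean ergodic shadowing if for every $\epsilon>0$ there is $\delta>0$ such that every $\delta$-ergodic pseudo orbit is $\epsilon$-shadowed in average by some point of $X$. *)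

(* Defs.v *)
From mathcomp Require Import all_boot all_order all_algebra.
From mathcomp Require Import all_classical all_reals all_analysis.

Set Implicit Arguments.
Unset Strict Implicit.
Unset Printing Implicit Defensive.

Import Order.TTheory GRing.Theory Num.Theory.
Import numFieldNormedType.Exports.

Local Open Scope classical_set_scope.
Local Open Scope ring_scope.

Definition density_zero (R : realType) (E : set nat) : Prop :=
  (n%:R^-1 * #|[pred i : 'I_n | (i : nat) \in E]|%:R : R) @[n --> \oo]
    --> (0 : R).

(* [arithmetic_mean v n] is the mean of the [n.+1] terms [v 0, ..., v n], so
   the averages over the first 1, 2, 3, ... terms are its terms of index
   0, 1, 2, ... *)

Section Shadowing.
Context {R : realType} {X : metricType R}.
Implicit Types (f : X -> X) (u : nat -> X) (x : X) (delta eps : R).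

Definition asymptotic_average_pseudo_orbit f u : Prop :=
  arithmetic_mean (fun i => mdist (f (u i)) (u i.+1)) @ \oo --> (0 : R).

Definition asymptotically_shadowed_in_average f u x : Prop :=
  arithmetic_mean (fun i => mdist (iter i f x) (u i)) @ \oo --> (0 : R).

Definition asymptotic_average_shadowing f : Prop :=
  forall u, asymptotic_average_pseudo_orbit f u ->
    exists x, asymptotically_shadowed_in_average f u x.

Definition ergodic_pseudo_orbit f delta u : Prop :=
  density_zero R [set i | delta <= mdist (f (u i)) (u i.+1)].

(* The limsup is taken in the extended reals, so that it is meaningful
   without any boundedness assumption. *)
Definition shadowed_in_average f eps u x : Prop :=
  (limn_esup (EFin \o arithmetic_mean (fun i => mdist (iter i f x) (u i)))
    < eps%:E)%E.

Definition mean_ergodic_shadowing f : Prop :=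
  forall eps, 0 < eps -> exists2 delta, 0 < delta &
    forall u, ergodic_pseudo_orbit f delta u ->
      exists x, shadowed_in_average f eps u x.

End Shadowing.

(* Main.v *)
Require Import Defs.
From mathcomp Require Import all_boot all_order all_algebra.
From mathcomp Require Import all_classical all_reals all_analysis.
From mathcomp Require Import ring lra.

(** The proof is by contraposition and diagonalization.  If mean ergodic
    shadowing fails at eps, then for each k there is a 1/(k+1)-ergodic pseudo
    orbit w k that no point eps-shadows in average.  Choose switching times
    0 = m 0 < m 1 < ... and let u follow w k, with its own time indices, on
    [m k, m k.+1).  If the m k grow fast enough, u is an asymptotic average
    pseudo orbit that no point shadows asymptotically in average.

    The errors of u average to 0: since the space is bounded, the k-th ergodic
    pseudo orbit has average error at most 2/(k+1) from some time on
    ([density_zero_series_le]), so it suffices to switch to w k after that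
    time, and to let each block dwarf the past, so that the average over an
    initial segment is governed by the last two blocks ([glued_mean_cvg0]).

    No point x shadows u: x fails to shadow w k, so the average distance from
    its orbit to w k exceeds eps/2 at arbitrarily late times, and by
    compactness there is a bound q on such a time that is uniform in x
    ([uniform_failure_time]).  Putting the next switch after q makes the
    failure visible in u, because the first m k terms, where u differs from
    w k, weigh little at late times.  Hence for every x the average distance
    from its orbit to u is at least eps/4 at arbitrarily late times. *)

Import Order.TTheory GRing.Theory Num.Theory.
Import numFieldNormedType.Exports.

Local Open Scope classical_set_scope.
Local Open Scope ring_scope.

(** * Averages of bounded sequences *)

Section Averages.
Context {R : realType}.
Implicit Types (e v : nat -> R) (D delta c : R).

Lemma arithmetic_mean_ltE v n c :
  (arithmetic_mean v n < c) = (series v n.+1 < c * n.+1%:R).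
Proof. by rewrite /arithmetic_mean /= mulrC ltr_pdivrMr ?ltr0n. Qed.

Lemma series_split v m n : (m <= n)%N ->
  series v n = series v m + \sum_(m <= i < n) v i.
Proof. by move=> mn; rewrite !seriesEnat /= (@big_cat_nat _ _ _ m). Qed.

Lemma ler_series_nat_bound e D n : (forall i, e i <= D) ->
  series e n <= D * n%:R.
Proof.
move=> eD; rewrite seriesEnat /= (le_trans (ler_sum _ (fun i _ => eD i)))//.
by rewrite sumr_const_nat subn0 mulr_natr.
Qed.

(** Phrased with [series] and a non-strict bound, convergence of the means to 0
    can be added up over blocks without any division. *)
Lemma arithmetic_mean_cvg0 v : (forall i, 0 <= v i) ->
  (arithmetic_mean v @ \oo --> (0 : R)) <->
  (forall c, 0 < c -> \forall n \near \oo, series v n <= c * n%:R).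
Proof.
move=> v0.
have s0 n : 0 <= arithmetic_mean v n.
  by rewrite /arithmetic_mean/= mulr_ge0// ?invr_ge0// seriesEnat /= sumr_ge0.
split.
  move=> /cvgrPdist_lt cv c /cv [M _ HM]; exists M.+1 => //= -[//|n] /= Mn.
  have := HM _ Mn; rewrite sub0r normrN ger0_norm// arithmetic_mean_ltE.
  exact: ltW.
move=> H; apply/cvgrPdist_lt => c c0.
have /H [M _ HM] : 0 < c / 2 by rewrite divr_gt0.
exists M => //= n Mn; rewrite sub0r normrN ger0_norm// arithmetic_mean_ltE.
rewrite (le_lt_trans (HM n.+1 _))//=; first exact: leqW.
by rewrite ltr_pM2r ?ltr0n// gtr_pMr// invf_lt1// ltr1n.
Qed.

(** The times where [e] is below delta contribute at most delta to the mean;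
    the other times have density less than delta / D eventually, and contribute
    at most another delta. *)
Lemma density_zero_series_le e D delta : 0 < delta -> 0 < D ->
    (forall i, e i <= D) -> density_zero R [set i | delta <= e i] ->
  \forall n \near \oo, series e n <= 2 * delta * n%:R.
Proof.
move=> delta0 D0 eD /cvgrPdist_lt /(_ (delta / D)) []; first exact: divr_gt0.
move=> M _ HM; exists M.+1 => //= n Mn.
have n0 : 0 < n%:R :> R by rewrite ltr0n (leq_trans _ Mn).
have /= := HM n (ltnW Mn).
rewrite sub0r normrN ger0_norm ?mulr_ge0 ?invr_ge0//.
rewrite mulrC ltr_pdivrMr// mulrAC ltr_pdivlMr// => H.
rewrite -mulrA mulr_natl mulr2n.
apply: (@le_trans _ _ (\sum_(i < n)
    (delta + (if (i : nat) \in [set i | delta <= e i] then D else 0)))).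
  rewrite seriesEord /=; apply: ler_sum => i _.
  case: ifPn => [_|]; first by rewrite (le_trans (eD _))// lerDr ltW.
  by rewrite notin_setE /= => /negP; rewrite -ltNge addr0 => /ltW.
rewrite big_split sumr_const card_ord -[delta *+ n]mulr_natr lerD2l.
rewrite -big_mkcond sumr_const -[D *+ _]mulr_natl.
by rewrite (le_trans _ (ltW H))// ler_wpM2r ?ltW.
Qed.

End Averages.

(** * Gluing sequences along switching times *)

Section Gluing.

(** The index of the block [m k, m k.+1) that contains [i].  The recursion
    moves up by at most one block at each step, which is enough when [m] is
    strictly increasing. *)
Fixpoint phase (m : nat -> nat) (i : nat) : nat :=
  if i is j.+1 then
    if (m (phase m j).+1 <= j.+1)%N then (phase m j).+1 else phase m j
  else 0.

Variable m : nat -> nat.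
Hypotheses (m0 : m 0 = 0%N) (mS : forall k, (m k < m k.+1)%N).

Lemma phase_bounds i : (m (phase m i) <= i < m (phase m i).+1)%N.
Proof.
elim: i => [|i /andP[IH1 IH2]] /=; first by have := mS 0; rewrite m0.
case: ifPn => [h|]; last by rewrite -ltnNge => ->; rewrite ltnW.
by rewrite h (leq_ltn_trans IH2).
Qed.

Lemma phaseE k i : (m k <= i < m k.+1)%N -> phase m i = k.
Proof.
have mono : {mono m : j l / (j < l)%N}.
  exact/leqW_mono/leq_mono/(homo_ltn ltn_trans).
move=> /andP[ki ik]; have /andP[pi ip] := phase_bounds i.
apply/eqP; rewrite eqn_leq; apply/andP; split; rewrite -ltnS -mono.
  exact: leq_ltn_trans pi ik.
exact: leq_ltn_trans ki ip.
Qed.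

Context {R : realType}.
Variables (D : R) (a : nat -> R) (e : nat -> R) (E : nat -> nat -> R).
Hypotheses (e_ge0 : forall i, 0 <= e i) (e_le : forall i, e i <= D).
Hypothesis E_ge0 : forall k i, 0 <= E k i.
(* The last index of a block is left out: for the errors of a glued pseudo
   orbit, the step from there leads into the next block. *)
Hypothesis eE : forall k i, (m k <= i)%N -> (i.+1 < m k.+1)%N -> e i <= E k i.

(** The extra [D] pays for the last index of the block, where [e] need not be
    dominated by [E k]. *)
Lemma block_sum_le k n : (m k <= n <= m k.+1)%N ->
  \sum_(m k <= i < n) e i <= series (E k) n + D.
Proof.
move=> /andP[kn nk].
have D0 : 0 <= D by exact: le_trans (e_ge0 0) (e_le 0).
have s0 j : 0 <= series (E k) j by rewrite seriesEnat /= sumr_ge0.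
case: n kn nk => [|j] kj jk; first by rewrite big_geq ?addr_ge0.
have [kj'|?] := leqP (m k) j; last by rewrite big_geq ?addr_ge0.
rewrite big_nat_recr //= lerD//.
rewrite seriesEnat /= [leRHS](@big_cat_nat _ _ _ (m k))//= ler_wpDl ?sumr_ge0//.
rewrite big_nat_recr //= ler_wpDr//.
apply: ler_sum_nat => i /andP[ki ij]; apply: eE => //.
exact: leq_ltn_trans ij _.
Qed.

Hypothesis mD : forall k, D * (m k).+1%:R <= a k * (m k.+1)%:R.
Hypothesis Ea : forall k n, (0 < k)%N -> (m k <= n)%N ->
  series (E k) n <= a k * n%:R.
Hypothesis a_cvg0 : a @ \oo --> (0 : R).

(** For n in block k+2, the sum of [e] up to n splits at m (k+1) and m (k+2).
    By [mD], the part before m (k+1) and the two boundary terms of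
    [block_sum_le] amount to at most 2 a (k+1) n; by [Ea], the two blocks
    contribute a (k+1) n and a (k+2) n.  This is four terms below c / 4 n. *)
Lemma glued_mean_cvg0 : arithmetic_mean e @ \oo --> (0 : R).
Proof.
have m_le : {homo m : j l / (j <= l)%N}.
  by apply: ltnW_homo; exact/(homo_ltn ltn_trans).
have D0 : 0 <= D by exact: le_trans (e_ge0 0) (e_le 0).
apply/(arithmetic_mean_cvg0 _ e_ge0) => c c0.
have [|K _ HK] := (iffLR (cvgrPdist_lt _ _) a_cvg0) (c / 4).
  by rewrite divr_gt0.
exists (m K.+2) => // n /= Kn.
have /andP[jn nj] := phase_bounds n.
(* Far enough out, n lies in a block of index at least 2, so that the block
   before it has positive index, as [Ea] requires. *)
move: (phase m n) jn nj => [|[|k]] jn nj.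
- by move: (leq_ltn_trans Kn nj); rewrite ltnNge m_le.
- by move: (leq_ltn_trans Kn nj); rewrite ltnNge m_le.
have kK : (K <= k)%N.
  rewrite leqNgt; apply/negP => kK.
  by move: (leq_ltn_trans Kn nj); rewrite ltnNge m_le.
have ac j : (K <= j)%N -> a j <= c / 4.
  by move=> /HK /=; rewrite sub0r normrN => /ltW; exact/le_trans/ler_norm.
have mn : (m k.+2)%:R <= n%:R :> R by rewrite ler_nat.
have n0 : 0 <= n%:R :> R by [].
have c4 : 0 <= c / 4 by rewrite divr_ge0// ltW.
rewrite (@series_split _ _ (m k.+2))// (@series_split _ _ (m k.+1)) ?m_le//.
have h1 := ler_series_nat_bound e D (m k.+1) e_le.
have h2 := block_sum_le k.+1 (m k.+2).
have h3 := block_sum_le k.+2 n.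
rewrite leqnn m_le// in h2; rewrite jn ltnW// in h3.
have h4 := Ea k.+1 (m k.+2) isT (m_le _ _ (leqnSn _)).
have h5 := Ea k.+2 n isT jn.
have h6 := mD k.+1.
have Dm : 0 <= D * (m k.+1)%:R by rewrite mulr_ge0.
rewrite -natr1 mulrDr mulr1 in h6.
have b1 : a k.+1 * (m k.+2)%:R <= c / 4 * n%:R.
  by apply: le_trans (ler_wpM2l c4 mn); rewrite ler_wpM2r// ac// leqW.
have b2 : a k.+2 * n%:R <= c / 4 * n%:R.
  by rewrite ler_wpM2r// ac// leqW// leqW.
have b3 : c * n%:R = 4 * (c / 4 * n%:R) by field.
rewrite b3; move: (h2 isT) (h3 isT); lra.
Qed.

End Gluing.

(** * Compactness *)

Section Compactness.
Context {R : realType} {X : metricType R}.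

Lemma mdist_continuous (a : X) : continuous (fun x : X => mdist x a : R).
Proof.
move=> x; apply/cvgrPdist_lt => c c0; near=> y.
have xy : mdist x y < c.
  near: y; have := nbhsx_ballx x _ c0.
  by rewrite ballEmdist.
rewrite ltr_norml; have := metric_triangle x y a; have := metric_triangle y x a.
rewrite (metric_sym y x); lra.
Unshelve. all: by end_near. Qed.

Lemma compact_mdist_bounded (x0 : X) : compact [set: X] ->
  exists2 D : R, 0 < D & forall x y : X, mdist x y <= D.
Proof.
move=> /compact_near_coveringP cX.
have /filter_ex[q Hq] :
    \forall q \near \oo, [set: X] `<=` [set x | mdist x x0 < q%:R :> R].
  apply: cX => x _; near=> y q => /=.
  have xy : mdist y x0 < mdist x x0 + 1.
    near: y; have := mdist_continuous x0 x.
    by move=> /cvgr_lt; apply; rewrite ltrDl.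
  apply: (lt_le_trans xy); near: q; exact: nbhs_infty_ger.
exists (2 * q%:R + 1) => [|x y]; first by rewrite ltr_wpDl// mulr_ge0.
have := metric_triangle x x0 y; rewrite (metric_sym x0 y).
have /= := Hq x Logic.I; have /= := Hq y Logic.I; lra.
Unshelve. all: by end_near. Qed.

Context {f : X -> X} (f_continuous : continuous f).

Lemma orbit_series_continuous (v : nat -> X) n :
  continuous (fun x => series (fun i => mdist (iter i f x) (v i)) n : R).
Proof.
have fi i : continuous (iter i f).
  elim: i => [|i IH] x; first exact: cvg_id.
  exact: (continuous_comp (IH x) (f_continuous _)).
elim: n => [|n IH] x.
  by under eq_fun do rewrite seriesEnat /= big_geq//; exact: cvg_cst.
under eq_fun do rewrite seriesSr.
apply: cvgD; first exact: IH.
exact: (continuous_comp (fi n x) (mdist_continuous _ _)).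
Qed.

Lemma not_shadowed_in_average (eps : R) v x N : 0 < eps ->
    ~ shadowed_in_average f eps v x ->
  exists2 n, (N <= n)%N &
    eps / 2 * n%:R < series (fun i => mdist (iter i f x) (v i)) n.
Proof.
move=> eps0 /negP; rewrite -leNgt /limn_esup limf_esupE => H.
set g := EFin \o _ in H.
have gN : (eps%:E <= ereal_sup (g @` [set n | (N <= n)%N]))%E.
  apply: (le_trans H); apply: ereal_inf_lbound.
  by exists [set n | (N <= n)%N] => //; exact: nbhs_infty_ge.
have : ((eps / 2)%:E < ereal_sup (g @` [set n | (N <= n)%N]))%E.
  by apply: lt_le_trans gN; rewrite lte_fin gtr_pMr// invf_lt1// ltr1n.
move=> /ereal_sup_gt[_ [n /= Nn <-]]; rewrite /g /= lte_fin => Hn.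
exists n.+1; first exact: leqW.
by move: Hn; rewrite ltr_pdivlMl ?ltr0n// mulrC.
Qed.

Hypothesis X_compact : compact [set: X].

(** Failure at a given time n is an open condition on the point, since it is a
    strict inequality between continuous functions; so finitely many times
    serve all points of a compact space. *)
Lemma uniform_failure_time (eps : R) v N : 0 < eps ->
    (forall x, ~ shadowed_in_average f eps v x) ->
  \forall q \near \oo, forall x, exists n, (N <= n < q)%N /\
    eps / 2 * n%:R < series (fun i => mdist (iter i f x) (v i)) n.
Proof.
move=> eps0 nsh.
have /compact_near_coveringP cX := X_compact.
suff : \forall q \near \oo, [set: X] `<=` [set x | exists n, (N <= n < q)%N /\
    eps / 2 * n%:R < series (fun i => mdist (iter i f x) (v i)) n].
  by apply: filterS => q Hq x; exact: Hq.
apply: cX => x _.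
have [n Nn xn] := not_shadowed_in_average _ _ _ N eps0 (nsh x).
near=> y q; exists n; split.
  by rewrite Nn /=; near: q; exact: nbhs_infty_gt.
rewrite /=; near: y; have := orbit_series_continuous v n x.
by move=> /cvgr_gt; exact.
Unshelve. all: by end_near. Qed.

End Compactness.

(** * The diagonal pseudo orbit *)

Section Diagonal.
Context {R : realType} {X : metricType R} {f : X -> X}.
Hypotheses (X_compact : compact [set: X]) (f_continuous : continuous f).
Variables (D eps : R) (w : nat -> nat -> X).
Hypotheses (D_gt0 : 0 < D) (mdist_le : forall x y : X, mdist x y <= D).
Hypotheses (eps_gt0 : 0 < eps)
  (w_ergodic : forall k, ergodic_pseudo_orbit f (harmonic k) (w k))
  (w_unshadowed : forall k x, ~ shadowed_in_average f eps (w k) x).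

Let err k i : R := mdist (f (w k i)) (w k i.+1).
Let gap k x i : R := mdist (iter i f x) (w k i).

(** What the switch from block k, begun at time p, to block k+1 has to wait for:
    q must dominate the past, [w k.+1] must have settled to its small average
    error, and every point must have failed to shadow [w k] so clearly that
    the deficit D p caused by the first p terms leaves eps/4. *)
Lemma next_switching_time k p : exists q, [/\ (p < q)%N,
    D * p.+1%:R <= 2 * harmonic k * q%:R,
    forall n, (q <= n)%N -> series (err k.+1) n <= 2 * harmonic k.+1 * n%:R &
    forall x, exists n, [/\ (k < n)%N, (p <= n < q)%N &
      eps / 4 * n%:R + D * p%:R <= series (gap k x) n]].
Proof.
(* From time N on, D p is at most a quarter of eps per time unit. *)
have [N _ HN] := nbhs_infty_ger (D * p%:R / (eps / 4)).
have /(_ k.+1) [M _ HM] := fun k => density_zero_series_le (err k) D _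
  (harmonic_gt0 k) D_gt0 (fun i => mdist_le _ _) (w_ergodic k).
apply: (@filter_ex _ \oo); near=> q; split.
- near: q; exact: nbhs_infty_gt.
- rewrite mulrC -ler_pdivrMl ?mulr_gt0// ?harmonic_gt0//.
  near: q; exact: nbhs_infty_ger.
- move=> n qn; apply: HM => /=; apply: leq_trans qn.
  near: q; exact: nbhs_infty_ge.
- move=> x.
  have [n [/andP[Nn nq] Hn]] : exists n, (maxn N (maxn k.+1 p) <= n < q)%N /\
      eps / 2 * n%:R < series (gap k x) n.
    move: x; near: q.
    exact: uniform_failure_time (w_unshadowed k).
  move: Nn; rewrite !geq_max => /and3P[Nn kn pn].
  exists n; split; rewrite ?pn//.
  have := HN n Nn; rewrite /= ler_pdivrMr ?divr_gt0// => Dp.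
  by lra.
Unshelve. all: by end_near. Qed.

(** Shadowing is refuted in block K at a time n > K: the sum of the distances
    to [w K] over [m K, n) is at least eps/4 n, and there the diagonal sequence
    agrees with [w K]. *)
Lemma diagonal_pseudo_orbit : exists2 u, asymptotic_average_pseudo_orbit f u &
  forall x, ~ asymptotically_shadowed_in_average f u x.
Proof.
have [g Hg] := choice (fun kp => next_switching_time kp.1 kp.2).
pose m := fix m k := if k is k'.+1 then g (k', m k') else 0%N.
have mP k : _ := Hg (k, m k); rewrite -/(m _.+1) /= in mP.
have mS k : (m k < m k.+1)%N by have [] := mP k.
have phE := phaseE m erefl mS.
exists (fun i => w (phase m i) i).
  apply: (glued_mean_cvg0 m erefl mS D (fun k => 2 * harmonic k) _ err) => //.
  - by move=> i; exact: mdist_ge0.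
  - by move=> k i; exact: mdist_ge0.
  - move=> k i ki ik; rewrite (phE k i) ?ki ?(ltnW ik)//.
    by rewrite (phE k i.+1) ?ik ?(leq_trans ki).
  - by move=> k; have [] := mP k.
  - by move=> [//|k] n _ kn; have [_ _ + _] := mP k; apply.
  - rewrite -[0](mulr0 2); apply: cvgM; [exact: cvg_cst|exact: cvg_harmonic].
(* Any constant below eps / 4 contradicts the failure times. *)
move=> x /(arithmetic_mean_cvg0 _ (fun i => mdist_ge0 _ _)) /(_ (eps / 8)) [].
  by rewrite divr_gt0.
move=> K _ HK; have [_ _ _ /(_ x) [n [Kn /andP[mn nm] Hn]]] := mP K.
have := HK n (ltnW Kn); rewrite leNgt => /negP; apply.
have n0 : 0 < n%:R :> R by rewrite ltr0n (leq_ltn_trans _ Kn).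
have c0 : eps / 8 * n%:R < eps / 4 * n%:R.
  by rewrite ltr_pM2r// ltr_pM2l// ltf_pV2 ?posrE// ltr_nat.
apply: (lt_le_trans c0).
rewrite (@series_split _ _ (m K))// in Hn.
have h1 : series (gap K x) (m K) <= D * (m K)%:R.
  by apply: ler_series_nat_bound => i; exact: mdist_le.
rewrite (@series_split _ _ (m K))//.
have h2 : 0 <= series (fun i => mdist (iter i f x) (w (phase m i) i) : R) (m K).
  by rewrite seriesEnat /= sumr_ge0// => i _; exact: mdist_ge0.
rewrite [X in _ <= _ + X](_ : _ = \sum_(m K <= i < n) gap K x i); first by lra.
apply: eq_big_nat => i /andP[Ki In].
by rewrite (phE K)// Ki (ltn_trans In).
Qed.

End Diagonal.

Theorem corollary3p10 (R : realType) (X : metricType R)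
    (X_compact : compact [set: X]) (X_two_points : exists x y : X, x <> y)
    (f : X -> X) (f_continuous : continuous f) :
  asymptotic_average_shadowing f -> mean_ergodic_shadowing f.
Proof.
move=> aas; have [x0 _] := X_two_points.
have [D D0 XD] := compact_mdist_bounded x0 X_compact.
move=> eps eps0; apply: contrapT => no_delta.
have no_shadow delta : 0 < delta -> exists u, ergodic_pseudo_orbit f delta u /\
    forall x, ~ shadowed_in_average f eps u x.
  move=> delta0; apply: contrapT => shadow; apply: no_delta.
  exists delta => // u u_erg; apply: contrapT => ushadow.
  apply: shadow; exists u; split => // x xu.
  by apply: ushadow; exists x.
have [w Hw] := choice (fun k => no_shadow (harmonic k) (harmonic_gt0 k)).
have [u u_po] := diagonal_pseudo_orbit X_compact f_continuous D eps w D0 XD eps0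
  (fun k => (Hw k).1) (fun k => (Hw k).2).
by have [x ux] := aas u u_po; move=> /(_ x).
Qed.
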